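(* Let $S\leq T(X)$ with $C_p(X)\subseteq S$. Then the following statements are equivalent: (i) $S$ is a maximal subsemigroup of $T(X)$. (ii) $S=T(X)\setminus H$ for some $H\in\mathcal{H}(FI(X)\cap Inj(X),\langle C_p(X)\rangle)$.
   Context: $X$ is a countably infinite set (one may take $X=\mathbb{N}$) and $T(X)$ is the monoid of all full transformations (maps $X\to X$) under composition. $A\leq B$ means that $A$ is a subsemigroup of $B$; $\langle A\rangle$ is the subsemigroup generated by $A$. A subsemigroup $S$ of $T(X)$ is maximal if $S\neq T(X)$ and there is no subsemigroup of $T(X)$ lying strictly between $S$ and $T(X)$. For $\alpha\in T(X)$: $im\,\alpha$ is its range, $rank(\alpha)=|im\,\alpha|$, the defect is $d(\alpha)=|X\setminus im\,\alpha|$, the collapse is $c(\alpha)=\sum_{y\in im\,\alpha}(|y\alpha^{-1}|-1)$, where $y\alpha^{-1}$ is the preimage of $y$, and the infinite contractive index is $k(\alpha)=|\{x\in im\,\alpha\mid |x\alpha^{-1}|=\aleph_0\}|$. $Inj(X)=\{\alpha\in T(X)\mid rank(\alpha)=\aleph_0,\ c(\alpha)=0,\ d(\alpha)\neq 0\}$; $C_p(X)=\{\alpha\in T(X)\mid rank(\alpha)=\aleph_0,\ k(\alpha)=\aleph_0\}$; $FI(X)=\{\alpha\in T(X)\mid rank(\alpha)=\aleph_0,\ d(\alpha)=\aleph_0,\ c(\alpha)<\aleph_0\}$. For a set $M$ of subsets of $T(X)$, let $J(M)$ be the set of all $A\subseteq T(X)$ such that: $A\subseteq\bigcup M=\{a\mid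 \exists m\in M,\ a\in m\}$; $A\cap m\neq\emptyset$ for all $m\in M$; and for every $\alpha\in A$ there exists $m\in M$ with $A\cap m=\{\alpha\}$. For $U\subseteq T(X)$ and $W\leq T(X)$ put $Gen(U)=\{A\subseteq T(X)\mid A \text{ is finite and } \langle A\rangle\cap U\neq\emptyset\}$ and $\mathcal{H}(U,W)=\{A\subseteq T(X)\setminus W\mid A\in J(Gen(U))\}$. *)

(* Defs.v *)
From mathcomp Require Import all_boot all_order all_algebra.
From mathcomp Require Import boolp classical_sets functions cardinality.
From mathcomp Require Import reals ereal esum counting_measure.
From mathcomp Require Import Rstruct.

Set Implicit Arguments.
Unset Strict Implicit.
Unset Printing Implicit Defensive.

Local Open Scope classical_set_scope.
Local Open Scope ereal_scope.

(* All sets considered below are subsets of a countable set, so every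
   cardinal is a natural number or aleph_0: cardinals live in [0, +oo], with
   +oo standing for aleph_0. *)
Definition ecard (X : choiceType) (A : set X) : \bar Rdefinitions.R :=
  counting A.

Definition aleph0 : \bar Rdefinitions.R := +oo.

Section Transformations.
Variable X : choiceType.
Implicit Types (f : X -> X) (A S U W : set (X -> X)).

(* The order of composition is irrelevant here: a set is closed under
   (f, g) |-> f \o g iff it is closed under (f, g) |-> g \o f. *)
Definition subsemigroup S := forall f g, S f -> S g -> S (f \o g).

(* The empty set counts as a subsemigroup, so that gen set0 = set0. *)
Definition gen A : set (X -> X) := smallest subsemigroup A.

Definition maximal_subsemigroup S :=
  [/\ subsemigroup S, S <> setT &
      ~ exists S', [/\ subsemigroup S', S `<` S' & S' `<` setT]].

Definition rank f : \bar Rdefinitions.R := ecard (range f).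

Definition defect f : \bar Rdefinitions.R := ecard (~` range f).

Definition collapse f : \bar Rdefinitions.R :=
  (\esum_(y in range f) (ecard (f @^-1` [set y]) - 1)%E)%R.

Definition contractive_index f : \bar Rdefinitions.R :=
  ecard [set x | range f x /\ ecard (f @^-1` [set x]) = aleph0].

Definition Inj_X : set (X -> X) :=
  [set f | [/\ rank f = aleph0, collapse f = 0 & defect f <> 0]].

Definition Cp_X : set (X -> X) :=
  [set f | rank f = aleph0 /\ contractive_index f = aleph0].

Definition FI_X : set (X -> X) :=
  [set f | [/\ rank f = aleph0, defect f = aleph0 & collapse f < aleph0]].

Definition J (M : set (set (X -> X))) : set (set (X -> X)) :=
  [set A | [/\ A `<=` \bigcup_(m in M) m,
               forall m, M m -> A `&` m !=set0 &
               forall a, A a -> exists m, M m /\ A `&` m = [set a]]].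

Definition Gen U : set (set (X -> X)) :=
  [set A | finite_set A /\ gen A `&` U !=set0].

Definition calH U W : set (set (X -> X)) :=
  [set A | A `<=` ~` W /\ J (Gen U) A].

End Transformations.

Arguments Inj_X {X}.
Arguments Cp_X {X}.
Arguments FI_X {X}.

(* Main.v *)
Require Import Defs.
From mathcomp Require Import all_boot boolp classical_sets functions cardinality.
From mathcomp Require Import all_order ssralg ssrnum finmap fsbigop ereal.
From mathcomp Require Import esum counting_measure Rstruct.
Local Open Scope classical_set_scope.

(** The point is that a subsemigroup S containing C_p(X) is all of T(X) as soon
    as it contains some mu in U = FI(X) :&: Inj(X): any alpha factors as
    beta \o mu, where beta undoes mu and then applies alpha on the image of mu,
    while on the infinite complement of that image beta is chosen so that every
    fibre is infinite, which puts beta in C_p(X). Hence, when C_p(X) <= S, S is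
    proper iff it misses U, and finiteness of products turns maximality of S
    into the minimality condition defining J(Gen(U)) for its complement. *)

Section Cardinals.
Variable X : choiceType.
Implicit Types (A : set X) (f : X -> X).

Lemma ecard_infinite A : ecard A = aleph0 <-> infinite_set A.
Proof.
rewrite /ecard /aleph0 /counting; split; last by move=> ?; rewrite asboolF.
by case: asboolP.
Qed.

Lemma ecard_set1 (x : X) : ecard [set x] = (1%R)%:E.
Proof. by rewrite /ecard /counting asboolT// fset_set1 cardfs1. Qed.

Lemma ecard_le1 A (x y : X) :
  (ecard A <= (1%R)%:E)%E -> A x -> A y -> x = y.
Proof.
rewrite /ecard /counting; case: asboolP => // finA.
rewrite lee_fin Num.Theory.lern1 => A1 Ax Ay; apply/eqP/negPn/negP => xy.
have : ([fset x; y] `<=` fset_set A)%fset.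
  by apply/fsubsetP => z; rewrite in_fset_set// in_fset2 => /orP[] /eqP ->;
    apply: mem_set.
by move=> /fsubset_leq_card; rewrite cardfs2 xy => /leq_trans/(_ A1).
Qed.

Lemma collapse_eq0 f : collapse f = 0%E <-> injective f.
Proof.
split=> [f0 x y fxy|injf]; last first.
  rewrite /collapse esum1// => _ [x _ <-].
  have -> : f @^-1` [set f x] = [set x].
    by apply/seteqP; split=> z /=; [apply: injf|move->].
  by rewrite ecard_set1 subee.
(* The term at [f x] is itself a finite partial sum, so it is at most the supremum defining the
   [\esum], which is 0. *)
apply: (@ecard_le1 (f @^-1` [set f x])) => //.
rewrite -sube_le0 -[leRHS]f0; apply: esum_ge.
exists [set f x]; last by rewrite fsbig_set1.
by split; [exact: finite_set1|move=> _ ->; exists x].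
Qed.

Lemma infinite_range (T V : Type) (f : T -> V) :
  injective f -> infinite_set [set: T] -> infinite_set (range f).
Proof.
move=> injf /infiniteP infT; apply/infiniteP/(card_le_trans infT).
have : (range f #= [set: T])%card by apply: inj_card_eq => ? ? _ _; exact: injf.
by rewrite card_eq_le => /andP[].
Qed.

(** Cuts out of [D] pairwise disjoint infinite blocks [i (x, _)], one for each point [x]: pairs are
    coded into [nat], which embeds in [D]. *)
Lemma inj_prod_nat D : countable [set: X] -> infinite_set D ->
  exists i : X * nat -> X, injective i /\ forall p, D (i p).
Proof.
move=> /countable_injP[c injc] /infiniteP/card_leP[g].
have memT (n : nat) : n \in [set: nat] := mem_set I.
pose i (p : X * nat) := set_val (g (SigSub (memT (choice.pickle (c p.1, p.2))))).
exists i; split=> [[x m] [y n]|p]; last exact: set_valP.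
move=> /val_inj/(@inj _ _ _ g _ _ (mem_set I) (mem_set I))[].
by move=> /(pcan_inj choice.pickleK)[/(injc _ _ (mem_set I) (mem_set I)) -> ->].
Qed.

End Cardinals.

Section Transformations.
Variable X : choiceType.
Hypothesis hX : ([set: X] #= [set: nat])%card.
Implicit Types (A S : set (X -> X)) (f : X -> X).

Local Notation U := (FI_X `&` Inj_X : set (X -> X)).

Let countableX : countable [set: X].
Proof. by move: hX; rewrite card_eq_le => /andP[]. Qed.

Let infiniteX : infinite_set [set: X].
Proof. by apply/infiniteP; move: hX; rewrite card_eq_le => /andP[]. Qed.

Lemma FI_InjP f : U f <-> injective f /\ infinite_set (~` range f).
Proof.
split=> [[[_ /ecard_infinite ? _] [_ /collapse_eq0 ? _]]//|[injf dinf]].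
have rf : rank f = aleph0.
  exact/ecard_infinite/infinite_range.
have df : defect f = aleph0 by exact/ecard_infinite.
have cf : collapse f = 0%E by exact/collapse_eq0.
by split; split; rewrite ?df ?cf ?ltry.
Qed.

Lemma FI_Inj_neq0 : U !=set0.
Proof.
have [i [inji _]] := inj_prod_nat _ _ countableX infiniteX.
have [x _] := infinite_setN0 infiniteX.
(* Only index 0 of each block is used, so the indices [n.+1] of a single block already give infinite
   defect. *)
exists (fun y => i (y, 0)); apply/FI_InjP; split=> [y z /inji[]//|].
apply: (@sub_infinite_set _ (range (fun n => i (x, n.+1)))).
  by move=> _ [n _ <-] [y _ /inji[]].
by apply: (infinite_range _ _ _ _ infinite_nat) => m n /inji[].
Qed.

Lemma infinite_fibers_Cp f :
  (forall y, infinite_set (f @^-1` [set y])) -> Cp_X f.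
Proof.
move=> inff; have rf : range f = setT.
  by apply/seteqP; split=> // y _; have [x <-] := infinite_setN0 (inff y); exists x.
split; first by rewrite /rank rf; exact/ecard_infinite.
rewrite /contractive_index rf (_ : [set _ | _] = setT); first exact/ecard_infinite.
by apply/seteqP; split=> // y _; split=> //; exact/ecard_infinite.
Qed.

Lemma Cp_comp_FI_Inj (mu f : X -> X) : U mu ->
  exists2 b : X -> X, Cp_X b & f = b \o mu.
Proof.
move=> /FI_InjP[injmu dmu].
have [i [inji iD]] := inj_prod_nat _ _ countableX dmu.
have [x0 _] := infinite_setN0 infiniteX.
(* The two requirements never compete, since [i] lands outside [range mu], and injectivity of [mu]
   and [i] makes each consistent. Elsewhere [x0] is an arbitrary value. *)
have /choice[b bP] (y : X) : exists z,
    (forall x, y = mu x -> z = f x) /\ (forall p, y = i p -> z = p.1).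
  have [[x _ <-]|nmu] := pselect (range mu y).
    exists (f x); split=> [x' /injmu <- //|p mui].
    by case: (iD p); exists x.
  have [[p _ <-]|ni] := pselect (range i y).
    exists p.1; split=> [x' imu|p' /inji <-//].
    by case: (iD p); exists x'.
  by exists x0; split=> [x yE|p yE]; [case: nmu|case: ni]; [exists x|exists p].
exists b; last by apply/funext => x /=; rewrite (proj1 (bP (mu x)) x erefl).
apply: infinite_fibers_Cp => y.
apply: (@sub_infinite_set _ (range (fun n => i (y, n)))).
  by move=> _ [n _ <-] /=; rewrite (proj2 (bP (i (y, n))) (y, n) erefl).
by apply: (infinite_range _ _ _ _ infinite_nat) => m n /inji[].
Qed.

Lemma subsemigroup_eqT S : subsemigroup S -> Cp_X `<=` S ->
  S `&` U !=set0 -> S = setT.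
Proof.
move=> hS hC [mu [Smu Umu]]; apply/seteqP; split=> // f _.
by have [b Cb ->] := Cp_comp_FI_Inj mu f Umu; apply: hS => //; apply: hC.
Qed.

Lemma subsemigroup_gen A : subsemigroup (gen A).
Proof.
move=> f g fA gA M MA; case: (MA) => hM _.
by apply: hM; [apply: fA|apply: gA].
Qed.

(** The maps generated by some finite part of [A] form a subsemigroup containing [A]: for a
    composite, take the union of the two finite parts. *)
Lemma gen_finite_support A f : gen A f ->
  exists m, [/\ finite_set m, m `<=` A & gen m f].
Proof.
apply: (smallest_sub
  (X := [set f | exists m, [/\ finite_set m, m `<=` A & gen m f]])).
  move=> {}f g [m [fm mA mf]] [n [fn nA ng]]; exists (m `|` n); split.
  - by rewrite finite_setU.
  - by rewrite subUset.
  - apply: subsemigroup_gen; [move: f mf|move: g ng]; apply: smallest_sub;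
      try exact: subsemigroup_gen.
    + by move=> h mh; apply: sub_gen_smallest; left.
    + by move=> h nh; apply: sub_gen_smallest; right.
move=> {}f Af; exists [set f]; split; [exact: finite_set1|by move=> _ ->|].
exact: sub_gen_smallest.
Qed.

End Transformations.

Theorem proposition18 (X : choiceType) (hX : ([set: X] #= [set: nat])%card)
  (S : set (X -> X)) (hS : subsemigroup S) (hC : Cp_X `<=` S) :
  maximal_subsemigroup S <->
  exists H : set (X -> X), calH (FI_X `&` Inj_X) (gen Cp_X) H /\ S = ~` H.
Proof.
have [mu Umu] := FI_Inj_neq0 X hX.
have sub_gen (A S' : set (X -> X)) : subsemigroup S' -> A `<=` S' -> gen A `<=` S'.
  by move=> ? ?; apply: smallest_sub.
split=> [[_ SneT Smax]|[H [[_ [_ Hm Hmin]] SE]]].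
  exists (~` S); split; last by rewrite setCK.
  split; first by rewrite setCS; exact: sub_gen.
  split.
  (* Adjoining [mu] puts any finite set into [Gen U]. *)
  - move=> a _; exists [set a; mu]; last by left.
    split; first by rewrite finite_setU; split; exact: finite_set1.
    by exists mu; split=> //; apply: sub_gen_smallest; right.
  (* If [m] missed the complement of [S], then [gen m] would lie in [S], so [S] would meet [U] and
     be everything. *)
  - move=> m [_ [f [mf Uf]]]; apply: contrapT => /set0P/negP/negPn/eqP SmE.
    apply: SneT; apply: (subsemigroup_eqT X hX) => //; exists f; split=> //.
    apply: sub_gen mf => // g mg; apply: contrapT => Sg.
    by rewrite -[False]/(set0 g) -SmE.
  - move=> a Sa.
    (* By maximality, [S] and [a] together generate [mu]; a finite part suffices, and it must
       contain [a] because [S] alone cannot produce [mu]. *)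
    have genT : gen (S `|` [set a]) = setT.
      apply: contrapT => genNT; apply: Smax; exists (gen (S `|` [set a])).
      split; first exact: subsemigroup_gen.
        split=> [f Sf|gS]; first by apply: sub_gen_smallest; left.
        by apply: Sa; apply: gS; apply: sub_gen_smallest; right.
      by split=> // gT; apply: genNT; apply/seteqP; split.
    have [|m [finm mSa mmu]] := gen_finite_support X (S `|` [set a]) mu.
      by rewrite genT.
    exists m; split; first by split=> //; exists mu.
    have ma : m a.
      apply: contrapT => nma; apply: SneT; apply: (subsemigroup_eqT X hX) => //.
      exists mu; split=> //; apply: sub_gen mmu => // g mg.
      by case: (mSa _ mg) => // ga; case: nma; rewrite -ga.
    by apply/seteqP; split=> [g [Sg mg]|_ ->//]; case: (mSa _ mg).
split=> // [ST|[S' [hS' [S'S SS'] [_ S'T]]]].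
  (* The singleton of [mu] belongs to [Gen U], so [H] is nonempty and [S] is proper. *)
  have [|f [Hf _]] := Hm [set mu].
    split; first exact: finite_set1.
    by exists mu; split=> //; exact: sub_gen_smallest.
  by move: Hf; rewrite -[H]setCK -SE ST setCT.
have [a [S'a Sa]] : exists a, S' a /\ ~ S a.
  apply: contrapT => noa; apply: SS' => a S'a.
  by apply: contrapT => Sa; apply: noa; exists a.
have Ha : H a by rewrite -[H]setCK -SE.
(* The only element of [m] outside [S] is [a], so [m] lies in [S'], which therefore meets [U]. *)
have [m [[_ [f [mf Uf]]] HmE]] := Hmin a Ha.
suff S'E : S' = setT by apply: S'T => g _; rewrite S'E.
apply: (subsemigroup_eqT X hX) => //; first by move=> g /hC/S'S.
exists f; split=> //; apply: sub_gen mf => // g mg.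
have [Hg|nHg] := pselect (H g); last by apply: S'S; rewrite SE.
by have -> : g = a by rewrite -[g = a]/([set a] g) -HmE.
Qed.
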